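(* Let $\mathcal{X}_1$ and $\mathcal{X}_2$ be two strong fuzzy graphs with $m$ and $n$ vertices respectively, and let $\mathcal{X}=\mathcal{X}_1+\mathcal{X}_2$ be their strong join, i.e. the join $\mathcal{X}_1+\mathcal{X}_2$ is a strong fuzzy graph. Then $$SDI(\mathcal{X})\le SDI(\mathcal{X}_1)+SDI(\mathcal{X}_2).$$
   Context: A fuzzy graph $\mathcal{X}=(\mathcal{V},\varrho,\upsilon)$ consists of a nonempty finite set $\mathcal{V}$ of vertices, a function $\varrho:\mathcal{V}\to[0,1]$ and a symmetric function $\upsilon:\mathcal{V}\times\mathcal{V}\to[0,1]$ with $\upsilon(ab)\le\min(\varrho(a),\varrho(b))$ for all $a,b$, and no loops ($\upsilon(aa)=0$). It is assumed that $\varrho(a)>0$ for all $a\in\mathcal{V}$; pairs $ab$ with $\upsilon(ab)>0$ are called edges. The join $\mathcal{X}_1+\mathcal{X}_2$ of fuzzy graphs $\mathcal{X}_1=(\mathcal{V}_1,\varrho_1,\upsilon_1)$ and $\mathcal{X}_2=(\mathcal{V}_2,\varrho_2,\upsilon_2)$ with $\mathcal{V}_1\cap\mathcal{V}_2=\emptyset$ has vertex set $\mathcal{V}_1\cup\mathcal{V}_2$, $\varrho(a)=\varrho_i(a)$ for $a\in\mathcal{V}_i$, $\upsilon(ab)=\upsilon_i(ab)$ for $a,b\in\mathcal{V}_i$, and $\upsilon(ab)=\min(\varrho(a),\varrho(b))$ for $a\in\mathcal{V}_1$, $b\in\mathcal{V}_2$. A path is a sequence of distinct vertices $a_1,\dots,a_k$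 with $\upsilon(a_ia_{i+1})>0$ for all $i<k$; its strength is the minimum of the weights $\upsilon$ of its edges. The strength of connectedness between $a$ and $b$ is the maximum of the strengths of all paths from $a$ to $b$ (and $0$ if there is none). An edge $ab$ is strong if $\upsilon(ab)$ is at least the strength of connectedness between $a$ and $b$ in the fuzzy graph obtained by deleting the edge $ab$. A fuzzy graph is strong if all its edges are strong. A set $\mathcal{D}\subseteq\mathcal{V}$ is a strong dominating set (SDS) if every $b\in\mathcal{V}\setminus\mathcal{D}$ is joined by a strong edge to some $a\in\mathcal{D}$. An SDS $\mathcal{D}$ is a minimal strong dominating set (MSDS) if $\mathcal{D}\setminus\{a\}$ is not an SDS for every $a\in\mathcal{D}$. The weight of $\mathcal{S}\subseteq\mathcal{V}$ is $W(\mathcal{S})=\sum_{a\in\mathcal{S}}\min\{\upsilon(ab): ab \text{ is a strong edge}\}$; whenever weights are used (here in $\mathcal{X}_1$, $\mathcal{X}_2$ and $\mathcal{X}$) it is understood that every vertex is incident with at least one strong edge. The strong domination degree ${}_{sd}d(u)$ of a vertex $u$ is the minimum of the weights of the MSDSs containing $u$; the strong domination index is $SDI(\mathcal{X})=\sum_{v\in\mathcal{V}}{}_{sd}d(v)$. *)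

(* Defs.v *)
From mathcomp Require Import all_boot all_order all_algebra.
Set Implicit Arguments.
Unset Strict Implicit.
Unset Printing Implicit Defensive.
Import Order.TTheory GRing.Theory Num.Theory.
Local Open Scope ring_scope.

Record fuzzyGraph (R : realFieldType) := FuzzyGraph {
  vert :> finType;
  rho : vert -> R;
  ups : vert -> vert -> R;
  vert_nonempty : (0 < #|vert|)%N;
  rho_gt0 : forall a, 0 < rho a;
  rho_le1 : forall a, rho a <= 1;
  ups_ge0 : forall a b, 0 <= ups a b;
  ups_le1 : forall a b, ups a b <= 1;
  ups_sym : forall a b, ups a b = ups b a;
  ups_le_min : forall a b, ups a b <= Num.min (rho a) (rho b);
  ups_loopless : forall a, ups a a = 0
}.

(* Minimum of a nonempty sequence; the value 0 on [::] is arbitrary. *)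
Definition seq_min (R : realFieldType) (s : seq R) : R :=
  if s is x :: s' then \big[Num.min/x]_(y <- s') y else 0.

Section Join.
Variables (R : realFieldType) (X1 X2 : fuzzyGraph R).

(* Disjointness of the two vertex sets is realised by the sum type. *)
Definition join_vert : finType := (vert X1 + vert X2)%type.

Definition join_rho (a : join_vert) : R :=
  match a with inl x => rho x | inr y => rho y end.

Definition join_ups (a b : join_vert) : R :=
  match a, b with
  | inl x, inl y => ups x y
  | inr x, inr y => ups x y
  | _, _ => Num.min (join_rho a) (join_rho b)
  end.

Fact join_nonempty : (0 < #|join_vert|)%N.
Proof. by rewrite card_sum addn_gt0 vert_nonempty. Qed.

Fact join_rho_gt0 a : 0 < join_rho a.
Proof. by case: a => x; apply: rho_gt0. Qed.

Fact join_rho_le1 a : join_rho a <= 1.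
Proof. by case: a => x; apply: rho_le1. Qed.

Fact join_ups_ge0 a b : 0 <= join_ups a b.
Proof.
by case: a b => [x|x] [y|y] /=; rewrite ?ups_ge0 // le_min !ltW ?rho_gt0.
Qed.

Fact join_ups_le1 a b : join_ups a b <= 1.
Proof.
by case: a b => [x|x] [y|y] /=; rewrite ?ups_le1 // ge_min !rho_le1.
Qed.

Fact join_ups_sym a b : join_ups a b = join_ups b a.
Proof. by case: a b => [x|x] [y|y] /=; rewrite 1?ups_sym // minC. Qed.

Fact join_ups_le_min a b : join_ups a b <= Num.min (join_rho a) (join_rho b).
Proof. by case: a b => [x|x] [y|y] //=; apply: ups_le_min. Qed.

Fact join_ups_loopless a : join_ups a a = 0.
Proof. by case: a => x /=; apply: ups_loopless. Qed.

Definition join : fuzzyGraph R :=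
  FuzzyGraph join_nonempty join_rho_gt0 join_rho_le1 join_ups_ge0 join_ups_le1
    join_ups_sym join_ups_le_min join_ups_loopless.

End Join.

Section DeleteEdge.
Variables (R : realFieldType) (X : fuzzyGraph R) (a b : X).

Definition del_ups (x y : X) : R :=
  if ((x == a) && (y == b)) || ((x == b) && (y == a)) then 0 else ups x y.

Fact del_ups_ge0 x y : 0 <= del_ups x y.
Proof. by rewrite /del_ups; case: ifP => // _; apply: ups_ge0. Qed.

Fact del_ups_le1 x y : del_ups x y <= 1.
Proof. by rewrite /del_ups; case: ifP => // _; apply: ups_le1. Qed.

Fact del_ups_sym x y : del_ups x y = del_ups y x.
Proof.
by rewrite /del_ups ups_sym orbC andbC [(x == a) && _]andbC.
Qed.

Fact del_ups_le_min x y : del_ups x y <= Num.min (rho x) (rho y).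
Proof.
rewrite /del_ups; case: ifP => _; last exact: ups_le_min.
by rewrite le_min !ltW ?rho_gt0.
Qed.

Fact del_ups_loopless x : del_ups x x = 0.
Proof. by rewrite /del_ups ups_loopless if_same. Qed.

Definition del_edge : fuzzyGraph R :=
  FuzzyGraph (vert_nonempty X) (@rho_gt0 _ X) (@rho_le1 _ X)
    del_ups_ge0 del_ups_le1 del_ups_sym del_ups_le_min del_ups_loopless.

End DeleteEdge.

Section Domination.
Variables (R : realFieldType) (X : fuzzyGraph R).

Definition edge : rel X := fun a b => 0 < ups a b.

(* The vertex sequence of the path is a :: p. *)
Definition is_path (a b : X) (p : seq X) : bool :=
  [&& uniq (a :: p), path edge a p & last a p == b].

Definition path_strength (a : X) (p : seq X) : R := seq_min (pairmap (@ups R X) a p).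

(* A path a :: p has distinct vertices, so p has fewer than #|X| elements. *)
Definition conn_strength (a b : X) : R :=
  \big[Num.max/0]_(k < #|X|)
    \big[Num.max/0]_(p : k.-tuple X | is_path a b p) path_strength a p.

End Domination.

Section StrongDomination.
Variables (R : realFieldType) (X : fuzzyGraph R).

Definition strong_edge : rel X := fun a b =>
  edge a b && (conn_strength (X := del_edge a b) a b <= ups a b).

Definition strong_graph : Prop := forall a b : X, edge a b -> strong_edge a b.

Definition has_strong_edges : Prop := forall a : X, exists b : X, strong_edge a b.

Definition SDS (D : {set X}) : bool :=
  [forall b in ~: D, [exists a in D, strong_edge a b]].

Definition MSDS (D : {set X}) : bool :=
  SDS D && [forall a in D, ~~ SDS (D :\ a)].

Definition weight (S : {set X}) : R :=
  \sum_(a in S) seq_min [seq ups a b | b <- enum X & strong_edge a b].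

(* When every vertex lies on a strong edge, a maximal independent set of the
   strong-edge relation containing u is an MSDS, so the minimum is over a
   nonempty family. *)
Definition sd_degree (u : X) : R :=
  seq_min [seq weight D | D : {set X} <- enum {set X} & MSDS D && (u \in D)].

Definition SDI : R := \sum_(v : X) sd_degree v.

End StrongDomination.

Arguments strong_graph {R} X.
Arguments has_strong_edges {R} X.
Arguments SDI {R} X.

(* Main.v *)
(** Every minimal strong dominating set D of a summand stays one in the join:
    any vertex of D dominates the whole other summand, while adjacency inside
    the summand is unchanged.  Each vertex of D only gains neighbours in the
    join, so the weight of D does not increase.  Hence the strong domination
    degree of each vertex does not increase either, and summing over all
    vertices gives the bound. *)
Require Import Defs.
From mathcomp Require Import all_boot all_order all_algebra.
Import Order.TTheory GRing.Theory Num.Theory.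
Local Open Scope ring_scope.

Lemma seq_min_le (R : realFieldType) (s : seq R) (x : R) :
  x \in s -> seq_min s <= x.
Proof.
case: s => [//|y s] /=; rewrite inE => /predU1P[->|xs].
  exact: bigmin_le_id.
exact: (ge_bigmin_seq _ _ predT id xs).
Qed.

Lemma seq_min_mem (R : realFieldType) (s : seq R) :
  s != [::] -> seq_min s \in s.
Proof.
case: s => [//|y s] _ /=.
rewrite big_seq_cond; elim/big_ind: _ => [|a b ha hb|i].
- exact: mem_head.
- by rewrite /Num.min; case: ifP.
- by rewrite andbT inE => ->; rewrite orbT.
Qed.

(* Nonemptiness of [s] matters because [seq_min [::] = 0]. *)
Lemma le_seq_min (R : realFieldType) (s t : seq R) :
  s != [::] -> (forall x, x \in s -> exists2 y, y \in t & y <= x) ->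
  seq_min t <= seq_min s.
Proof.
move=> /seq_min_mem ms st; have [y yt yx] := st _ ms.
exact: le_trans (seq_min_le _ _ _ yt) yx.
Qed.

Lemma mem_neq_nil (T : eqType) (s : seq T) (x : T) : x \in s -> s != [::].
Proof. by case: s. Qed.

(** In a strong graph domination becomes ordinary adjacency, so path strengths play no further
    part. *)
Lemma strong_edgeE (R : realFieldType) (X : fuzzyGraph R) (a b : X) :
  strong_graph X -> strong_edge a b = edge a b.
Proof. by move=> sX; apply/idP/idP => [/andP[]|/sX]. Qed.

(* Witness: a maximal independent set containing [u]. *)
Lemma MSDS_exists (R : realFieldType) (X : fuzzyGraph R) (u : X) :
  strong_graph X -> exists2 D : {set X}, MSDS D & u \in D.
Proof.
move=> sX.
pose indep (D : {set X}) := [forall a in D, forall b in D, ~~ edge a b].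
have loopless (a : X) : edge a a = false by rewrite /edge ups_loopless ltxx.
have symE (a b : X) : edge a b = edge b a by rewrite /edge ups_sym.
have indepP (D : {set X}) :
    reflect {in D &, forall a b, ~~ edge a b} (indep D).
  apply: (iffP idP) => [iD a b aD bD|iD].
    by move/forall_inP: iD => /(_ a aD) /forall_inP /(_ b bD).
  by apply/forall_inP => a aD; apply/forall_inP => b bD; apply: iD.
have indep_u : indep [set u].
  by apply/indepP => a b /set1P -> /set1P ->; rewrite loopless.
have [D /maxsetP[/indepP iD maxD] uD] := maxset_exists indep_u.
exists D; last by rewrite -sub1set.
apply/andP; split; last first.
  (* Minimality: once [a] is removed, [a] itself is undominated, since independence leaves it no
     neighbour in [D]. *)
  apply/forall_inP => a aD; apply/negP => /forall_inP /(_ a).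
  rewrite !inE eqxx => /(_ isT) /exists_inP[b /setD1P[_ bD]].
  by rewrite strong_edgeE //; apply/negP; apply: iD.
(* Domination: an undominated [b] could be added to [D] without losing independence, against
   maximality. *)
apply/forall_inP => b; rewrite inE => bD; apply: contraNT bD => nb.
have nbD a : a \in D -> ~~ edge a b.
  move=> aD; apply: contra nb => eab.
  by apply/exists_inP; exists a; rewrite // strong_edgeE.
rewrite -(maxD (b |: D)) ?subsetUr ?setU11 //.
apply/indepP => x y /setU1P[->|xD] /setU1P[->|yD].
- by rewrite loopless.
- by rewrite symE nbD.
- exact: nbD.
- exact: iD.
Qed.

Section DominatingEmbedding.
Variables (R : realFieldType) (X Y : fuzzyGraph R) (f : X -> Y).
Hypotheses (sX : strong_graph X) (sY : strong_graph Y).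
(** These hypotheses abstract the inclusion of a summand into the join, so that [inl] and [inr]
    share one argument. *)
Hypothesis f_inj : injective f.
Hypothesis ups_f : forall a b, ups (f a) (f b) = ups a b.
Hypothesis edge_f : forall a y, y \notin codom f -> edge (f a) y.

Lemma strong_edge_embed (a b : X) :
  strong_edge (f a) (f b) = strong_edge a b.
Proof. by rewrite !strong_edgeE // /edge ups_f. Qed.

(* Nonemptiness of [D] is needed to dominate the vertices outside [codom f]. *)
Lemma SDS_embed (D : {set X}) : D != set0 -> SDS (f @: D) = SDS D.
Proof.
case/set0Pn => d dD; apply/idP/idP => /forall_inP domD; apply/forall_inP.
  move=> b; rewrite inE => bD.
  have /domD/exists_inP[_ /imsetP[a aD ->]] : f b \in ~: (f @: D).
    by rewrite inE mem_imset.
  by rewrite strong_edge_embed => ab; apply/exists_inP; exists a.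
move=> y; rewrite inE => yD; have [/codomP[b yE]|yf] := boolP (y \in codom f).
  move: yD; rewrite yE mem_imset // => bD.
  have /exists_inP[a aD ab] : [exists a in D, strong_edge a b].
    by apply: domD; rewrite inE.
  by apply/exists_inP; exists (f a); rewrite ?imset_f ?strong_edge_embed.
apply/exists_inP; exists (f d); first exact: imset_f.
by rewrite strong_edgeE //; apply: edge_f.
Qed.

(** By injectivity, removing a vertex commutes with taking the image, so minimality transfers
    through [SDS_embed]. *)
Lemma MSDS_embed (D : {set X}) : D != set0 -> MSDS D -> MSDS (f @: D).
Proof.
move=> D0 /andP[domD /forall_inP minD]; rewrite /MSDS SDS_embed // domD /=.
apply/forall_inP => _ /imsetP[a aD ->].
have -> : f @: D :\ f a = f @: (D :\ a).
  apply/setP => y; apply/setD1P/imsetP => [[ya /imsetP[b bD yE]]|].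
    exists b => //; rewrite in_setD1 bD andbT.
    by apply: contra_neq ya; rewrite yE => ->.
  by case=> b /setD1P[ba bD] ->; rewrite inj_eq // imset_f.
(* If [D] is a singleton, [SDS_embed] does not apply; but the empty set cannot dominate any
   [f b]. *)
have [Da0|Da0] := eqVneq (D :\ a) set0; last by rewrite SDS_embed ?minD.
apply: contra (minD a aD) => /forall_inP dom; rewrite Da0.
apply/forall_inP => b _.
have /dom/exists_inP[y] : f b \in ~: (f @: (D :\ a)).
  by rewrite Da0 imset0 !inE.
by rewrite Da0 imset0 inE.
Qed.

Lemma weight_embed_le (D : {set X}) :
  has_strong_edges X -> weight (f @: D) <= weight D.
Proof.
move=> eX; rewrite /weight big_imset => [|? ? _ _ /f_inj //].
apply: ler_sum => a _; apply: le_seq_min.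
  (* A strong edge at [a] in [X] rules out the default value 0 of [seq_min]. *)
  have [b ab] := eX a; apply: (mem_neq_nil _ _ (ups a b)).
  by apply: map_f; rewrite mem_filter ab mem_enum.
move=> _ /mapP[b + ->]; rewrite mem_filter => /andP[ab _].
exists (ups a b) => //; rewrite -ups_f; apply: map_f.
by rewrite mem_filter strong_edge_embed ab mem_enum.
Qed.

Lemma sd_degree_embed_le (u : X) :
  has_strong_edges X -> sd_degree (f u) <= sd_degree u.
Proof.
move=> eX; apply: le_seq_min.
  (* Likewise, the degree of [u] must be a genuine minimum of weights. *)
  have [D mD uD] := MSDS_exists _ _ u sX.
  apply: (mem_neq_nil _ _ (weight D)).
  by apply: map_f; rewrite mem_filter mD uD mem_enum.
move=> _ /mapP[D + ->]; rewrite mem_filter => /andP[/andP[mD uD] _].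
exists (weight (f @: D)); last exact: weight_embed_le.
apply: map_f; rewrite mem_filter mem_enum imset_f // !andbT.
by apply: MSDS_embed => //; apply/set0Pn; exists u.
Qed.

End DominatingEmbedding.

Theorem theorem4p24 (R : realFieldType) (X1 X2 : fuzzyGraph R) (m n : nat)
    (card_X1 : #|X1| = m) (card_X2 : #|X2| = n)
    (strong_X1 : strong_graph X1) (strong_X2 : strong_graph X2)
    (strong_X : strong_graph (join X1 X2))
    (edges_X1 : has_strong_edges X1) (edges_X2 : has_strong_edges X2)
    (edges_X : has_strong_edges (join X1 X2)) :
  SDI (join X1 X2) <= SDI X1 + SDI X2.
Proof.
rewrite /SDI [X in X <= _]big_sumType /=.
apply: lerD; apply: ler_sum => u _.
- apply: (@sd_degree_embed_le R X1 (join X1 X2) inl) => //.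
  + by move=> ? ? [].
  + move=> a [b|b]; first by rewrite codom_f.
    (* A cross pair has weight the minimum of two positive values. *)
    by move=> _; rewrite /edge /= lt_min !rho_gt0.
- apply: (@sd_degree_embed_le R X2 (join X1 X2) inr) => //.
  + by move=> ? ? [].
  + move=> a [b|b]; last by rewrite codom_f.
    by move=> _; rewrite /edge /= lt_min !rho_gt0.
Qed.
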